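(* Let $\Phi$ be an Orlicz function satisfying the $\Delta_2$-condition. There is a constant $C_\Phi>0$ depending only on $\Phi$ such that for every $n\in\mathbb N$ and every sequence $\{f_k\}_{k=1}^n\subset L_\Phi[0,1]$ of positive independent random variables, $$\mathbb{E}\Big(\Phi\big(\max_{1\le k\le n}f_k\big)\Big)\approx_{C_\Phi}\mathbb{E}\Big(\Phi\big(\mu(f)\chi_{(0,1)}\big)\Big),\qquad f=\bigoplus_{k=1}^n f_k.$$
   Context: $X\approx_C Y$ means $X\le CY$ and $Y\le CX$. Random variables are a.e. finite real-valued Lebesgue measurable functions on $(0,1)$ with Lebesgue measure $\mathbb P$; $\mathbb E(g)=\int_0^1 g(t)\,dt$; ''positive'' means $\ge 0$. An Orlicz function is an even convex function $\Phi:\mathbb R\to[0,\infty)$ with $\Phi(0)=0$; it satisfies the $\Delta_2$-condition if there is $C$ with $\Phi(2t)\le C\Phi(t)$ for all $t>0$. $L_\Phi[0,1]$ is the set of measurable $g$ on $[0,1]$ with $\|g\|_{L_\Phi}=\inf\{\lambda>0:\int_0^1\Phi(g(t)/\lambda)\,dt\le1\}<\infty$. The disjoint sum $\bigoplus_{k=1}^n f_k$ is the function on $(0,\infty)$ equal to $f_k(t-k+1)$ for $t\in(k-1,k)$, $1\le k\le n$, and $0$ for $t\geq n$. For measurable $g$ on $(0,\infty)$, $\mu(g)$ is the decreasing rearrangement of $|g|$: $\mu(t,g)=\inf\{u\ge0:\mathrm{Leb}\{|g|>u\}\le t\}$, $t>0$; thus $\mathbb E(\Phi(\mu(f)\chi_{(0,1)}))=\int_0^1\Phi(\mu(t,f))\,dt$.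 *)

(* Defs.v *)
From HB Require Import structures.
From mathcomp Require Import all_boot all_order all_algebra.
From mathcomp Require Import all_classical all_reals all_analysis.
Set Implicit Arguments.
Unset Strict Implicit.
Unset Printing Implicit Defensive.
Import Order.TTheory GRing.Theory Num.Theory.
Import numFieldNormedType.Exports.
Local Open Scope classical_set_scope.
Local Open Scope ring_scope.

(* The reals with the sigma-algebra of Lebesgue (not only Borel) measurable
   sets, on which [completed_lebesgue_measure] is a measure. *)
Definition lebesgueTypeR (R : realType) : measurableType _ :=
  caratheodory_type (@wlength R idfun)^*%mu.

Definition leb {R : realType} : {measure set (lebesgueTypeR R) -> \bar R} :=
  @completed_lebesgue_measure R.

Definition lebesgue_measurable_fun {R : realType} (D : set R) (g : R -> R) :=
  measurable_fun (D : set (lebesgueTypeR R)) (g : lebesgueTypeR R -> R).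

(* Expectation of a random variable on (0, 1); values outside (0, 1) are
   irrelevant. It is extended-real valued, so no integrability is presupposed. *)
Definition expect {R : realType} (g : R -> R) : \bar R :=
  (\int[leb]_(t in `]0%R, 1%R[) (g t)%:E)%E.

Definition prob {R : realType} (A : set R) : \bar R :=
  leb (`]0, 1[ `&` A).

Definition independent {R : realType} (n : nat) (f : 'I_n -> R -> R) :=
  forall (J : {set 'I_n}) (B : 'I_n -> set R),
    (forall k, measurable (B k)) ->
    prob (\bigcap_(k in [set` J]) f k @^-1` B k) =
    (\prod_(k in J) prob (f k @^-1` B k))%E.

Definition positive_rv {R : realType} (g : R -> R) :=
  {ae (@leb R), forall t : R, 0 < t < 1 -> 0 <= g t}.

Record orlicz {R : realType} (Phi : R -> R) : Prop := Orlicz {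
  orlicz_ge0 : forall x, 0 <= Phi x;
  orlicz0 : Phi 0 = 0;
  orlicz_even : forall x, Phi (- x) = Phi x;
  orlicz_convex : convex_function [set: R^o] Phi }.

Definition Delta2 {R : realType} (Phi : R -> R) :=
  exists C : R, forall t, 0 < t -> Phi (2 * t) <= C * Phi t.

(* The infimum is taken in the extended reals: the norm is +oo when no
   admissible l exists. *)
Definition orlicz_norm {R : realType} (Phi g : R -> R) : \bar R :=
  ereal_inf [set l%:E | l in [set l : R | 0 < l /\
    (\int[leb]_(t in `[0%R, 1%R]) (Phi (g t / l))%:E <= 1)%E]].

Definition orlicz_space {R : realType} (Phi : R -> R) : set (R -> R) :=
  [set g | lebesgue_measurable_fun `[0, 1] g /\ (orlicz_norm Phi g < +oo)%E].

(* Indices start at 0: [f k] is transplanted onto (k, k + 1), and the sum takes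
   the value 0 at the integers. *)
Definition disjoint_sum {R : realType} (n : nat) (f : 'I_n -> R -> R) (t : R) :=
  \sum_(k < n) (if k%:R < t < k.+1%:R then f k (t - k%:R) else 0).

(* Decreasing rearrangement of |g| for g on (0, +oo). The infimum is real, with
   the junk value 0 when the set is empty; the set is never empty for t > 0 when
   g is real-valued, measurable and supported on a set of finite measure. *)
Definition rearrangement {R : realType} (g : R -> R) (t : R) : R :=
  inf [set u : R | 0 <= u /\
    (leb [set s : R | (0 < s)%R /\ (u < `|g s|)%R] <= t%:E)%E].

(* Pointwise maximum; the initial value 0 is harmless for positive functions. *)
Definition max_rv {R : realType} (n : nat) (f : 'I_n -> R -> R) (t : R) : R :=
  \big[Num.max/0]_(k < n) f k t.

Definition equiv_upto {R : realType} (C : R) (X Y : \bar R) :=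
  (X <= C%:E * Y)%E /\ (Y <= C%:E * X)%E.

(* Main.v *)
(* For u >= 0 put p_k(u) = P(f_k > u). By independence
   P(max f_k > u) = 1 - prod (1 - p_k(u)), while the disjoint sum exceeds u on a
   set of measure sum p_k(u), so that P(mu(f) > u) = min(1, sum p_k(u)) on
   (0, 1). Elementary bounds give
   1 - prod (1 - p_k) <= min(1, sum p_k) <= 2 (1 - prod (1 - p_k)).
   Since the superlevel sets of Phi on [0, +oo) are open half-lines, the layer
   cake formula turns this comparison of tails into a comparison of the
   expectations of Phi, with the constant 2 for every Orlicz function. *)
Require Import Defs.
From HB Require Import structures.
From mathcomp Require Import all_boot all_order all_algebra.
From mathcomp Require Import all_classical all_reals all_analysis.
From mathcomp Require Import measurable_realfun ring lra.
Import Order.TTheory GRing.Theory Num.Theory.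
Import numFieldNormedType.Exports.
Local Open Scope classical_set_scope.
Local Open Scope ring_scope.

(** * Superlevel sets of Orlicz functions *)

Section orlicz_superlevel.
Context {R : realType} (Phi : R -> R).
Hypothesis oPhi : orlicz Phi.

Lemma orlicz_convexR (l x y : R) : 0 <= l <= 1 ->
  Phi (l * x + (1 - l) * y) <= l * Phi x + (1 - l) * Phi y.
Proof.
move=> /andP[l0 l1].
have := orlicz_convex oPhi (Itv01 l0 l1) (x := x) (y := y).
by rewrite !inE => /(_ Logic.I Logic.I).
Qed.

(** Convexity between [0] and [y], with [Phi 0 = 0], gives [Phi x <= (x / y) * Phi y]. *)
Lemma orlicz_nondecreasing (x y : R) : 0 <= x <= y -> Phi x <= Phi y.
Proof.
move=> /andP[x0 xy]; have [y0|y0] := ltP 0 y; last first.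
  by have -> : x = y by apply/eqP; rewrite eq_le xy (le_trans y0).
have l1 : 0 <= x / y <= 1 by rewrite divr_ge0 ?(ltW y0)//= ler_pdivrMr ?mul1r.
have := @orlicz_convexR _ y 0 l1.
rewrite mulr0 addr0 (orlicz0 oPhi) mulr0 addr0 divfK ?gt_eqF// => /le_trans->//.
by rewrite ler_piMl ?(orlicz_ge0 oPhi)//; case/andP: l1.
Qed.

(* Left continuity of [Phi] at [a]. For [a'] close to [a], the point [a] is a
   convex combination of [a'] and [2 * a] putting small weight [th] on [2 * a],
   so [Phi a' <= s] would force [Phi a] below its value. *)
Lemma orlicz_superlevel_open (s a : R) : 0 <= s -> 0 <= a -> s < Phi a ->
  exists a', 0 <= a' < a /\ s < Phi a'.
Proof.
move=> s0 a0 sa.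
have {}a0 : 0 < a.
  rewrite lt_neqAle a0 andbT; apply: contraTneq sa => <-.
  by rewrite (orlicz0 oPhi) -leNgt.
have aa : Phi a <= Phi (2 * a) by apply: orlicz_nondecreasing; lra.
set d := Phi (2 * a) - s; have d0 : 0 < d by rewrite /d; lra.
(* If [Phi a' <= s], convexity gives [Phi a <= s + th * d], which this [th] makes the midpoint of
   [s] and [Phi a]. *)
set th := (Phi a - s) / (2 * d).
have thE : th * d = (Phi a - s) / 2 by rewrite /th; field; lra.
have th0 : 0 < th by rewrite divr_gt0//; lra.
have th2 : th <= 1 / 2.
  by rewrite ler_pdivrMr ?mulr_gt0// /d; lra.
exists (a * (1 - 2 * th) / (1 - th)).
have a'E : a * (1 - 2 * th) / (1 - th) * (1 - th) = a * (1 - 2 * th).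
  by rewrite divfK//; lra.
set a' := _ / _ in a'E *; split.
  apply/andP; split; first by rewrite /a' divr_ge0 ?mulr_ge0//; lra.
  by rewrite /a' ltr_pdivrMr; nra.
rewrite ltNge; apply/negP => sa'.
have := @orlicz_convexR (1 - th) a' (2 * a).
have -> : (1 - th) * a' + (1 - (1 - th)) * (2 * a) = a by rewrite mulrC a'E; ring.
have -> : Phi (2 * a) = d + s by rewrite /d; ring.
have : 0 <= 1 - th <= 1 by lra.
move=> /[swap] /[apply]; nra.
Qed.

(** The part of [[0, +oo[] where [Phi > s] is upward closed by monotonicity and omits its infimum by
    left continuity. The first case is that of an empty set. *)
Lemma orlicz_superlevel (s : R) : 0 <= s ->
  (forall x, 0 <= x -> (s < Phi x) = false) \/
  exists2 a, 0 <= a & forall x, 0 <= x -> (s < Phi x) = (a < x).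
Proof.
move=> s0; pose S := [set x | 0 <= x /\ s < Phi x].
have [S0|/set0P[y0 Sy0]] := eqVneq S set0.
  left=> x x0; apply/negbTE/negP => sx.
  by have : set0 x by rewrite -S0.
have lS : lbound S 0 by move=> x [].
have hS : has_inf S by split; [exists y0|exists 0].
right; exists (inf S) => [|x x0]; first by apply: lb_le_inf => //; exists y0.
apply/idP/idP => [sx|].
  have [a' [/andP[a'0 a'x] sa']] := orlicz_superlevel_open s x s0 x0 sx.
  by apply: le_lt_trans a'x; apply: ge_inf => //; exists 0.
move/(inf_lt (ex_intro _ y0 Sy0)) => [y [y_ge0 sy] yx].
by apply: (lt_le_trans sy); rewrite orlicz_nondecreasing// y_ge0 ltW.
Qed.
End orlicz_superlevel.

(** * Layer cake formula and comparison of tails *)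

Section layer_cake.
Local Open Scope ereal_scope.
Context d (T : measurableType d) (R : realType)
  (mu : {sigma_finite_measure set T -> \bar R}) (D : set T).
Hypothesis mD : measurable D.

Section subgraph.
Variable X : T -> R.
Hypotheses (mX : measurable_fun D X) (X0 : forall t, D t -> (0 <= X t)%R).

(** The region under the graph of [X], extended by zero. Its sections at [t] in [D] have length
    [X t], those at [s >= 0] have the tail as measure, and Tonelli equates the two integrals. *)
Let A : set (T * measurableTypeR R) :=
  [set z | ((0 <= z.2) && (z.2 < (X \_ D) z.1))%R].

Let mA : measurable A.
Proof.
have mY : measurable_fun setT (X \_ D) by apply/(measurable_restrictT _ mD).
rewrite -[A]setTI; apply: (measurable_and _ _ measurableT) => //.
- exact: measurable_fun_ler.
- by apply: measurable_fun_ltr => //; exact: measurableT_comp.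
Qed.

Let tailE : (fun s => mu (D `&` [set t | (s < X t)%R])) \_ `[0%R, +oo[ =
  mu \o ysection A.
Proof.
apply/funext => s; rewrite patchE /=.
case: ifPn => [|]; rewrite ?inE ?notin_setE/= in_itv/= andbT => s0.
  congr (mu _); apply/seteqP; split => t;
    rewrite /ysection/= inE /A/= s0/= patchE.
    by move=> [/mem_set ->].
  by case: ifPn => [/set_mem//|_]; rewrite ltNge s0.
rewrite [X in mu X](_ : _ = set0) ?measure0//.
by apply/seteqP; split => t //; rewrite /ysection/= inE /A/= => /andP[].
Qed.

Lemma measurable_fun_tail : measurable_fun (`[0%R, +oo[%classic : set (measurableTypeR R))
  (fun s => mu (D `&` [set t | (s < X t)%R])).
Proof.
apply/(measurable_restrictT _ _) => //; rewrite tailE.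
rewrite -indic_fubini_tonelli_GE//.
exact: indic_measurable_fun_fubini_tonelli_G.
Qed.

Lemma layer_cake : \int[mu]_(t in D) (X t)%:E =
  \int[lebesgue_measure]_(s in `[0%R, +oo[) mu (D `&` [set t | (s < X t)%R]).
Proof.
have := indic_fubini_tonelli mu lebesgue_measure mA.
rewrite indic_fubini_tonelli_FE// indic_fubini_tonelli_GE// => AE.
rewrite [RHS]integral_mkcond tailE -AE [LHS]integral_mkcond.
apply: eq_integral => t _ /=.
have -> : xsection A t = `[0%R, (X \_ D) t[%classic.
  by apply/seteqP; split => s; rewrite /xsection/= inE /A/= in_itv.
rewrite lebesgue_measure_itv/= lte_fin !patchE.
case: ifPn => [/set_mem tD|_]; last by rewrite ltxx.
by rewrite oppr0 adde0; case: ltgtP (X0 t tD) => // <-.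
Qed.

End subgraph.

Lemma ge0_le_integral_tail (c : R) (X Y : T -> R) : (0 <= c)%R ->
    measurable_fun D X -> measurable_fun D Y ->
    (forall t, D t -> 0 <= X t)%R -> (forall t, D t -> 0 <= Y t)%R ->
    (forall s, (0 <= s)%R -> mu (D `&` [set t | (s < X t)%R]) <=
      c%:E * mu (D `&` [set t | (s < Y t)%R])) ->
  \int[mu]_(t in D) (X t)%:E <= c%:E * \int[mu]_(t in D) (Y t)%:E.
Proof.
move=> c0 mX mY X0 Y0 XY; rewrite !layer_cake//.
rewrite -ge0_integralZl//=; last exact: measurable_fun_tail.
apply: ge0_le_integral => //=; first exact: measurable_fun_tail.
- exact: (measurable_funeM _ (measurable_fun_tail Y mY)).
- by move=> s; rewrite in_itv/= andbT => s0; exact: XY.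
Qed.

End layer_cake.

(** The rays []s, +oo[] generate the Borel sets. *)
Lemma measurable_fun_superlevel d (T : measurableType d) (R : realType)
    (D : set T) (f : T -> R) :
  (forall s, measurable (D `&` [set t | s < f t])) -> measurable_fun D f.
Proof.
move=> mf mD; apply: (measurability _ (RGenOInfty.measurableE R)) => //.
move=> _ [_ [s ->] <-]; rewrite preimage_itvoy; exact: mf.
Qed.

(** * Expectations of Orlicz functions *)

Section expect.
Context {R : realType}.

Lemma measurable_leb (A : set R) :
  measurable A -> measurable (A : set (lebesgueTypeR R)).
Proof. exact: sub_caratheodory. Qed.

Lemma leb_itvoo (a b : R) : a <= b -> leb `]a, b[%classic = (b - a)%:E.
Proof.
move=> ab; transitivity (lebesgue_measure `]a, b[%classic) => //.
rewrite lebesgue_measure_itv/= lte_fin; case: ltgtP ab => // -> _.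
by rewrite subrr.
Qed.

(** For [s >= 0], the event [s < Phi X] is empty or equal to [a < X], with the same [a >= 0] for [X]
    and [Y]. So the tail bound passes to [Phi X] and [Phi Y], and the layer cake formula integrates
    it. *)
Lemma le_expect_orlicz (Phi : R -> R) (c : R) (X Y : R -> R) :
    orlicz Phi -> 0 <= c ->
    lebesgue_measurable_fun `]0, 1[ X -> lebesgue_measurable_fun `]0, 1[ Y ->
    (forall t, 0 < t < 1 -> 0 <= X t) -> (forall t, 0 < t < 1 -> 0 <= Y t) ->
    (forall u, 0 <= u ->
       (prob [set t | (u < X t)%R] <= c%:E * prob [set t | (u < Y t)%R])%E) ->
  (expect (fun t => Phi (X t)) <= c%:E * expect (fun t => Phi (Y t)))%E.
Proof.
move=> oPhi c0 mX mY X0 Y0 XY.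
have m01 : measurable (`]0, 1[%classic : set (lebesgueTypeR R)).
  by apply: measurable_leb.
have mPhi Z : lebesgue_measurable_fun `]0, 1[ Z ->
    (forall t, 0 < t < 1 -> 0 <= Z t) ->
    lebesgue_measurable_fun `]0, 1[ (fun t => Phi (Z t)).
  move=> mZ Z0; apply: measurable_fun_superlevel => s.
  have [s0|s0] := ltP s 0.
    rewrite (_ : _ `&` _ = `]0, 1[%classic)//; apply/seteqP; split => t [] //.
    by move=> t01; split => //=; rewrite (lt_le_trans s0)// (orlicz_ge0 oPhi).
  have [sE|[a a0 sE]] := orlicz_superlevel Phi oPhi s s0.
    rewrite (_ : _ `&` _ = set0)//; apply/seteqP; split => t //= [].
    by rewrite in_itv/= => /Z0/sE ->.
  rewrite (_ : _ `&` _ = `]0, 1[%classic `&` Z @^-1` `]a, +oo[%classic).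
    exact: mZ.
  apply/seteqP; split => t /= []; rewrite !in_itv/= andbT => t01;
    by rewrite sE// Z0.
apply: (@ge0_le_integral_tail _ _ _ (@completed_lebesgue_measure R)
  `]0%R, 1%R[%classic m01) => //.
- exact: mPhi.
- exact: mPhi.
- by move=> t _; exact: orlicz_ge0.
- by move=> t _; exact: orlicz_ge0.
move=> s s0.
have [sE|[a a0 sE]] := orlicz_superlevel Phi oPhi s s0.
  rewrite (_ : _ `&` _ = set0); first by rewrite measure0 mule_ge0.
  by apply/seteqP; split => t //= []; rewrite in_itv/= => /X0/sE ->.
have tE Z : (forall t, 0 < t < 1 -> 0 <= Z t) ->
    `]0, 1[%classic `&` [set t | s < Phi (Z t)] =
    `]0, 1[%classic `&` [set t | a < Z t].
  move=> Z0; apply/seteqP; split => t /= []; rewrite in_itv/= => t01;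
    by rewrite sE// Z0.
by rewrite !tE//; exact: XY.
Qed.

End expect.

(** * Translation invariance of Lebesgue measure *)

Section translation.
Context {R : realType}.
Implicit Types (A : set R) (c : R).

(* Completed Lebesgue measure is an infimum over covers by half-open intervals,
   and covers can be translated. *)
Let leb_shift_le A c : (leb [set x | A (x - c)%R] <= leb A)%E.
Proof.
rewrite /leb/=; apply: le_ereal_inf_tmp => _ [F [mF AF] <-].
apply: ereal_inf_lbound; exists (fun i => [set x | F i (x - c)%R]).
  split=> [i|x /= /AF[i _ Fi]]; last by exists i.
  have [[a b] _ <-] := mF i; exists (a + c, b + c) => //=.
  by apply/seteqP; split => x /=; rewrite !in_itv/= ltrBrDr lerBlDr.
apply: eq_eseriesr => i _; have [[a b] _ <-] := mF i => /=.
rewrite [X in wlength _ X](_ : _ = `]a + c, b + c]%classic).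
  rewrite !wlength_itv/= !lte_fin ltrD2r; case: ifP => // _.
  by rewrite -!EFinB; congr EFin; ring.
by apply/seteqP; split => x /=; rewrite !in_itv/= ltrBrDr lerBlDr.
Qed.

Lemma leb_shift A c : leb [set x | A (x - c)%R] = leb A.
Proof.
apply/eqP; rewrite eq_le leb_shift_le/=.
apply: le_trans (leb_shift_le [set x | A (x - c)%R] (- c)).
by rewrite [X in (_ <= leb X)%E](_ : _ = A)//; apply/seteqP;
  split => x /=; rewrite opprK addrK.
Qed.

(** In the Caratheodory criterion, cutting [X] by the translate of [A] amounts to cutting the
    back-translate of [X] by [A], and the outer measure of each piece is invariant. *)
Lemma measurable_leb_shift A c : measurable (A : set (lebesgueTypeR R)) ->
  measurable ([set x | A (x - c)] : set (lebesgueTypeR R)).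
Proof.
move=> mA; apply: le_caratheodory_measurable => X.
have XE : X = [set x | [set y | X (y + c)] (x - c)].
  by apply/seteqP; split => x /=; rewrite subrK.
rewrite -[X in (X + _ <= _)%E]/(leb _) -[X in (_ + X <= _)%E]/(leb _).
rewrite -[leRHS]/(leb _) [in leRHS]XE !leb_shift.
have := mA [set y | X (y + c)].
rewrite -[LHS]/(leb _) -[X in _ = X + _]/(leb _) -[X in _ = _ + X]/(leb _) => ->.
rewrite -(leb_shift (_ `&` A) c) -(leb_shift (_ `&` ~` A) c).
rewrite le_eqVlt; apply/orP; left; apply/eqP; congr (leb _ + leb _)%E;
  by apply/seteqP; split => x /=; rewrite subrK.
Qed.

End translation.

(** * Elementary bounds on products *)

Section prod_onem.
Context {R : realFieldType} {I : Type} (r : seq I) (p : I -> R).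
Hypothesis p01 : forall i, 0 <= p i <= 1.

Let q := \prod_(i <- r) (1 - p i).
Let S := \sum_(i <- r) p i.

(* [q * (1 + S) <= 1] stands in for the usual [q <= exp (- S)]. *)
Let prod_onem_bounds : [/\ 0 <= q, q <= 1, 0 <= S, 1 - S <= q & q * (1 + S) <= 1].
Proof.
rewrite /q /S; elim: r => [|i s]; first by rewrite !big_nil; split; lra.
rewrite !big_cons; move: (\prod_(_ <- _) _) (\sum_(_ <- _) _) (p01 i) => x y.
(* For the last bound, [(1 - p i) * (1 + p i + y) = 1 + y - p i * (p i + y) <= 1 + y]. *)
by move=> /andP[p0 p1] [x0 x1 y0 xy1 xy]; split; nra.
Qed.

Lemma onem_prod_le_min_sum : 1 - q <= Num.min 1 S.
Proof. by case: prod_onem_bounds => *; rewrite le_min; apply/andP; split; lra. Qed.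

(** From [q <= 1 / (1 + S)]: if [S >= 1], then [q <= 1 / 2]; if [S < 1], then
    [2 * (1 - q) >= 2 * S / (1 + S) >= S]. *)
Lemma min_sum_le_onem_prod : Num.min 1 S <= 2 * (1 - q).
Proof. by case: prod_onem_bounds => *; case: (leP 1 S) => ?; nra. Qed.

End prod_onem.

(** * Level sets and the decreasing rearrangement *)

Section rearrangement.
Context {R : realType} (g : R -> R).
Let E (u : R) := [set s : R | (0 < s)%R /\ (u < `|g s|)%R].
Hypothesis mE : forall u : R, 0 <= u -> measurable (E u : set (lebesgueTypeR R)).
Hypothesis finE : (leb (E 0%R) < +oo)%E.

Let leb_level u v : 0 <= u -> u <= v -> (leb (E v) <= leb (E u))%E.
Proof.
move=> u0 uv; apply: le_measure; rewrite ?inE; try apply: mE => //.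
  exact: le_trans uv.
by move=> s [s0 /(le_lt_trans uv)].
Qed.

(** Continuity from above: the sets [E n] decrease to the empty set, and [E 0] has finite measure.
    So the infimum defining the rearrangement is not the default value. *)
Let leb_level_small t : 0 < t -> exists2 u, 0 <= u & (leb (E u) <= t%:E)%E.
Proof.
move=> t0; pose F (n : nat) : set (lebesgueTypeR R) := E n%:R.
have F0 : \bigcap_n F n = set0.
  apply/seteqP; split => // s Fs; pose m := Num.bound `|g s|.
  have [_] := Fs m Logic.I; apply/negP; rewrite -leNgt ltW//.
  by rewrite /m (le_lt_trans (ler_norm _))// normr_id archi_boundP.
have : leb \o F @ \oo --> (0 : \bar R).
  rewrite -(measure0 (@leb R)) -F0; apply: nonincreasing_cvg_mu => //.
  - by move=> n; exact: mE.
  - by rewrite F0.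
  - move=> m n mn; apply/subsetPset => s [s0 /= ns]; split => //.
    by rewrite (le_lt_trans _ ns)// ler_nat.
move=> /(_ [set x | (x < t%:E)%E])[].
  by apply: open_nbhs_nbhs; split; [exact: open_ereal_lt_ereal|rewrite /= lte_fin].
by move=> n _ /(_ n (leqnn n))/= /ltW; exists n%:R.
Qed.

(** Right continuity of the distribution function: [E u] is the increasing union of the sets
    [E (u + 1 / (n + 1))]. *)
Let leb_level_right u t : 0 <= u -> (t%:E < leb (E u))%E ->
  exists2 v, u < v & (t%:E < leb (E v))%E.
Proof.
move=> u0; pose F (n : nat) : set (lebesgueTypeR R) := E (u + n.+1%:R^-1).
have F_ge0 n : 0 <= u + n.+1%:R^-1 by rewrite addr_ge0.
have FE : \bigcup_n F n = E u.
  apply/seteqP; split=> [s [n _ [s0 ns]]|s [s0 us]].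
    by split => //; rewrite (lt_trans _ ns)// ltrDl.
  have gu : 0 < `|g s| - u by rewrite subr_gt0.
  have [n _ /(_ n (leqnn n))/= nus] := near_infty_natSinv_lt (PosNum gu).
  by exists n => //; split => //; rewrite -ltrBrDl.
move=> tu; have : leb \o F @ \oo --> leb (E u).
  rewrite -FE; apply: nondecreasing_cvg_mu => //.
  - by move=> n; exact: mE.
  - by rewrite FE; exact: mE.
  - move=> m n mn; apply/subsetPset => s [s0 /= ns]; split => //.
    by rewrite (le_lt_trans _ ns)// lerD2l lef_pV2 ?posrE// ler_nat.
move=> /(_ [set x | (t%:E < x)%E])[].
  by apply: open_nbhs_nbhs; split; [exact: open_ereal_gt_ereal|].
move=> n _ /(_ n (leqnn n))/= tn; exists (u + n.+1%:R^-1) => //.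
by rewrite ltrDl.
Qed.

(** If [leb (E u) <= t], then [u] competes in the infimum. Otherwise right continuity gives [v > u]
    with [leb (E v) > t], and [v] bounds all competitors from below, which makes the inequality
    strict. *)
Lemma rearrangement_gtE u t : 0 <= u -> 0 < t ->
  (u < rearrangement g t) = (t%:E < leb (E u))%E.
Proof.
move=> u0 t0; rewrite /rearrangement; set S := [set _ | _].
have lS : lbound S 0 by move=> x [].
apply/idP/idP.
  apply: contraTT; rewrite -!leNgt => Eu; apply: ge_inf => //.
  by exists 0.
move=> /(leb_level_right _ _ u0) [v uv tv]; apply: (lt_le_trans uv).
have [w w0 wt] := leb_level_small t t0.
apply: lb_le_inf; first by exists w.
move=> x [x0 xt]; rewrite leNgt; apply/negP => /ltW/(leb_level _ _ x0).
by move=> /(lt_le_trans tv)/lt_le_trans => /(_ _ xt); rewrite ltxx.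
Qed.

End rearrangement.

(** * Tails of the maximum and of the disjoint sum *)

Section independent_positive.
Context {R : realType} (n : nat) (f : 'I_n -> R -> R).
Hypothesis mf : forall k, lebesgue_measurable_fun `[0, 1] (f k).

Let m01 : measurable (`]0, 1[%classic : set (lebesgueTypeR R)).
Proof. exact: measurable_leb. Qed.

Let mf01 k : lebesgue_measurable_fun `]0, 1[ (f k).
Proof.
apply: measurable_funS (mf k); first exact: measurable_leb.
by apply: subset_itv; rewrite bnd_simp.
Qed.

Let m_level k u : measurable
  (`]0, 1[%classic `&` [set t | u < f k t] : set (lebesgueTypeR R)).
Proof.
rewrite (_ : [set t | u < f k t] = f k @^-1` `]u, +oo[%classic).
  exact: mf01.
by apply/seteqP; split => t /=; rewrite in_itv/= andbT.
Qed.

Let prob_le1 (A : set R) :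
  measurable (`]0, 1[%classic `&` A : set (lebesgueTypeR R)) ->
  (prob A <= 1%:E)%E.
Proof.
move=> mA; rewrite -[1]subr0 -(leb_itvoo 0 1 ler01).
by apply: le_measure; rewrite ?inE//; exact: subIsetl.
Qed.

Let p k u := fine (prob [set t | u < f k t]).

Let pE k u : prob [set t | u < f k t] = (p k u)%:E.
Proof.
rewrite /p fineK// ge0_fin_numE ?measure_ge0//.
by rewrite (le_lt_trans (prob_le1 _ _))// ltry.
Qed.

Let p01 u k : 0 <= p k u <= 1.
Proof. by rewrite -!lee_fin -pE measure_ge0 prob_le1. Qed.

Let prob_setC (A : set R) :
  measurable (`]0, 1[%classic `&` A : set (lebesgueTypeR R)) ->
  prob (~` A) = (1 - prob A)%E.
Proof.
move=> mA; have <- : leb (`]0, 1[%classic : set R) = 1%E.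
  by rewrite leb_itvoo// subr0.
rewrite /prob (_ : _ `&` ~` A = `]0, 1[%classic `\` (`]0, 1[%classic `&` A)).
  rewrite measureD//; last by rewrite [X in (X < _)%E](leb_itvoo 0 1 ler01) ltry.
  by rewrite setIA setIid.
by apply/seteqP; split => t /= [t01] => [nA|/not_andP[]//]; split => // -[].
Qed.

(** The condition [0 <= u] keeps the initial value [0] of the maximum from exceeding [u]. *)
Let max_level u : 0 <= u ->
  [set t | u < max_rv f t] = \bigcup_k [set t | u < f k t].
Proof.
move=> u0; apply/seteqP; split => t /=.
  apply: contraPP => nf; apply/negP; rewrite -leNgt; apply/bigmax_leP.
  split => // k _; rewrite leNgt; apply/negP => uk.
  by apply: nf; exists k.
by move=> [k _ /=] /lt_le_trans; apply; exact: le_bigmax.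
Qed.

Let m_max_level u : 0 <= u -> measurable
  (`]0, 1[%classic `&` [set t | u < max_rv f t] : set (lebesgueTypeR R)).
Proof.
move=> u0; rewrite max_level// setI_bigcupr.
by apply: fin_bigcup_measurable => //; exact: finite_finset.
Qed.

Lemma measurable_max_rv : lebesgue_measurable_fun `]0, 1[ (max_rv f).
Proof.
apply: measurable_fun_superlevel => s; have [s0|/m_max_level//] := ltP s 0.
rewrite (_ : _ `&` _ = `]0, 1[%classic)//; apply/seteqP; split => t [] // t01.
by split => //=; rewrite (lt_le_trans s0)// /max_rv; exact: bigmax_ge_id.
Qed.

Lemma prob_max_rv u : independent f -> 0 <= u ->
  prob [set t | u < max_rv f t] = (1 - \prod_(k < n) (1 - p k u))%:E.
Proof.
move=> indep u0; rewrite -[X in prob X]setCK prob_setC; last first.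
  rewrite (_ : _ `&` _ = `]0, 1[%classic `\`
    (`]0, 1[%classic `&` [set t | u < max_rv f t])).
    by apply: measurableD => //; exact: m_max_level.
  by apply/seteqP; split => t /= [t01] => [nA|/not_andP[]//]; split => // -[].
rewrite EFinB; congr (_ - _)%E; rewrite max_level// setC_bigcup.
(* The complement is the event that all [f k <= u]; independence is applied to the full index set
   and to half-lines. *)
transitivity (prob (\bigcap_(k in [set` [set: 'I_n]%SET])
    f k @^-1` `]-oo, u]%classic)).
  congr (prob _); apply/seteqP; split => t /= ft k _.
    by rewrite /= in_itv/= leNgt; apply/negP; exact: ft.
  by have := ft k; rewrite /= inE in_itv/= leNgt => /(_ isT)/negP.
rewrite indep; last by move=> k; exact: measurable_itv.
rewrite (big_morph EFin EFinM erefl); apply: eq_big => [k|k _]; first by rewrite inE.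
rewrite (_ : f k @^-1` _ = ~` [set t | u < f k t]) ?prob_setC// ?pE//.
by apply/seteqP; split => t /=; rewrite in_itv/= leNgt => /negP.
Qed.

Hypothesis f_ge0 : forall k, positive_rv (f k).

Let absf_level k (u : R) : set (lebesgueTypeR R) :=
  `]0, 1[%classic `&` [set t | u < `|f k t|].

Let m_absf_level k (u : R) : measurable (absf_level k u).
Proof.
have mabs : lebesgue_measurable_fun `]0, 1[ (fun t => `|f k t|).
  by apply: measurableT_comp => //; exact: mf01.
rewrite /absf_level (_ : [set t | _] = (fun t => `|f k t|) @^-1` `]u, +oo[%classic).
  exact: mabs.
by apply/seteqP; split => t /=; rewrite in_itv/= andbT.
Qed.

(** As [f k] is nonnegative only almost everywhere, the level sets of [f k] and of its absolute
    value may differ, but only within a null set. *)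
Let leb_absf_level k (u : R) : leb (absf_level k u) = (p k u)%:E.
Proof.
rewrite -pE; apply/eqP; rewrite eq_le; apply/andP; split; last first.
  apply: le_measure; rewrite ?inE//.
  by move=> t [t01 /= /lt_le_trans ut]; split => //=; rewrite ut// ler_norm.
have [N [mN N0 fN]] := f_ge0 k.
apply: (@le_trans _ _
  (leb ((`]0, 1[%classic `&` [set t | u < f k t]) `|` N))).
  apply: le_measure; rewrite ?inE//; first exact: measurableU.
  move=> t [t01 /= ut]; have [ft|ft] := leP 0 (f k t).
    by left; split => //=; rewrite ger0_norm in ut.
  by right; apply: fN => /= /(_ t01); rewrite leNgt ft.
by rewrite (le_trans (measureU2 _ _ _))// [X in (_ + X)%E]N0 adde0.
Qed.

Let disjoint_sumE (k : 'I_n) (s : R) : k%:R < s < k.+1%:R ->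
  disjoint_sum f s = f k (s - k%:R).
Proof.
move=> ks; rewrite /disjoint_sum (bigD1 k)//= ks big1 ?addr0// => j jk.
case: ifP => // js; case/andP: ks => k1 k2; case/andP: js => j1 j2.
have := lt_trans k1 j2; have := lt_trans j1 k2; rewrite !ltr_nat !ltnS => jlek klej.
by move: jk; rewrite -val_eqE/= eqn_leq jlek klej.
Qed.

(** On [(k, k + 1)] the level set is a translate of that of [|f k|]. At integers and beyond [n] the
    sum is [0], never above [u >= 0]. *)
Let disjoint_sum_level u : 0 <= u ->
  [set s | (0 < s)%R /\ (u < `|disjoint_sum f s|)%R] =
  \bigcup_k [set s | absf_level k u (s - k%:R)].
Proof.
move=> u0; apply/seteqP; split => s /=.
  move=> [s0 us]; suff [k ks] : exists k : 'I_n, k%:R < s < k.+1%:R.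
    exists k => //; split; last by rewrite /= -disjoint_sumE.
    by rewrite /= in_itv/= subr_gt0 ltrBlDr -natr1 addrC in ks *.
  apply: contrapT => nk; move: us; rewrite /disjoint_sum big1.
    by rewrite normr0 ltNge u0.
  by move=> k _; case: ifP => // ks; exfalso; apply: nk; exists k.
move=> [k _ [/=]]; rewrite in_itv/= subr_gt0 ltrBlDr addrC natr1 => ks.
rewrite -disjoint_sumE// => us; split => //.
by case/andP: ks => + _; apply: le_lt_trans.
Qed.

Lemma measurable_disjoint_sum_level u : 0 <= u -> measurable
  ([set s | (0 < s)%R /\ (u < `|disjoint_sum f s|)%R] : set (lebesgueTypeR R)).
Proof.
move=> u0; rewrite disjoint_sum_level//.
apply: fin_bigcup_measurable; first exact: finite_finset.
by move=> k _; exact: measurable_leb_shift.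
Qed.

(** The translates lie in disjoint intervals, so their measures add up, and translation invariance
    turns each into [p k u]. *)
Lemma leb_disjoint_sum_level u : 0 <= u ->
  leb [set s | (0 < s)%R /\ (u < `|disjoint_sum f s|)%R] =
  (\sum_(k < n) p k u)%:E.
Proof.
move=> u0; rewrite disjoint_sum_level// measure_fin_bigcup//.
- rewrite -sumEFin (fsbig_seq _ _ (index_enum_uniq _)).
  rewrite (_ : [set` index_enum _] = setT); last first.
    by apply/seteqP; split => // k _; rewrite /= mem_index_enum.
  apply: eq_fsbigr => k _; rewrite -leb_absf_level; exact: (leb_shift (absf_level k u)).
- exact: finite_finset.
- move=> j k _ _ [s [[/= + _] [/= + _]]]; rewrite !in_itv/= !subr_gt0 !ltrBlDr.
  rewrite !(addrC 1) !natr1 => /andP[j1 j2] /andP[k1 k2].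
  have := lt_trans k1 j2; have := lt_trans j1 k2; rewrite !ltr_nat !ltnS => jk kj.
  by apply/val_inj/eqP; rewrite /= eqn_leq jk kj.
- by move=> k _; exact: measurable_leb_shift.
Qed.

Let rearr_gtE u t : 0 <= u -> 0 < t < 1 ->
  (u < rearrangement (disjoint_sum f) t * \1_(`]0, 1[%classic) t) =
  (t < \sum_(k < n) p k u).
Proof.
move=> u0 /andP[t0 t1]; rewrite indicE mem_set ?mulr1; last first.
  by rewrite /= in_itv/= t0.
rewrite rearrangement_gtE//; first by rewrite leb_disjoint_sum_level.
  exact: measurable_disjoint_sum_level.
by rewrite leb_disjoint_sum_level// ltry.
Qed.

(** The explicit interval yields both the measurability of the rearrangement and its tail. *)
Let rearr_level u : 0 <= u ->
  `]0, 1[%classic `&`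
    [set t | u < rearrangement (disjoint_sum f) t * \1_(`]0, 1[%classic) t] =
  `]0, Num.min 1 (\sum_(k < n) p k u)[%classic.
Proof.
move=> u0; apply/seteqP; split => t /=; rewrite !in_itv/= lt_min.
  by move=> [t01]; rewrite rearr_gtE// => ->; rewrite !andbT.
by move=> /and3P[t0 t1 tp]; rewrite t0 t1 rearr_gtE// t0.
Qed.

Lemma rearrangement_ge0 (g : R -> R) t : 0 <= rearrangement g t.
Proof.
rewrite /rearrangement; set S := [set _ | _].
(* The infimum of the empty set is [0], so the sign holds for arbitrary [g]. *)
have [->|/set0P S0] := eqVneq S set0; first by rewrite inf0.
by apply: lb_le_inf => // x [].
Qed.

Lemma measurable_rearrangement : lebesgue_measurable_fun `]0, 1[
  (fun t => rearrangement (disjoint_sum f) t * \1_(`]0, 1[%classic) t).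
Proof.
apply: measurable_fun_superlevel => s; have [s0|s0] := ltP s 0; last first.
  by rewrite rearr_level//; exact: measurable_leb.
rewrite (_ : _ `&` _ = `]0, 1[%classic)//; apply/seteqP; split => t [] // t01.
by split => //=; rewrite (lt_le_trans s0)// mulr_ge0// rearrangement_ge0.
Qed.

Lemma prob_rearrangement u : 0 <= u ->
  prob [set t | u < rearrangement (disjoint_sum f) t * \1_(`]0, 1[%classic) t]
  = (Num.min 1 (\sum_(k < n) p k u))%:E.
Proof.
move=> u0; rewrite /prob rearr_level// leb_itvoo ?subr0//.
by rewrite le_min ler01 sumr_ge0// => k _; case/andP: (p01 u k).
Qed.

Lemma prob_max_rearrangement u : independent f -> 0 <= u ->
  let X := prob [set t | u < max_rv f t] in
  let Y := prob [set t |
    u < rearrangement (disjoint_sum f) t * \1_(`]0, 1[%classic) t] in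
  (X <= Y)%E /\ (Y <= 2%:E * X)%E.
Proof.
move=> indep u0 /=; rewrite prob_max_rv// prob_rearrangement// -EFinM !lee_fin.
by split; [exact/onem_prod_le_min_sum/p01|exact/min_sum_le_onem_prod/p01].
Qed.

End independent_positive.

(** * Comparison of the two expectations *)

Theorem theorem1p4 (R : realType) (Phi : R -> R)
    (orlicz_Phi : orlicz Phi) (Delta2_Phi : Delta2 Phi) :
  exists2 C : R, 0 < C &
    forall (n : nat) (f : 'I_n -> R -> R),
      (forall k, orlicz_space Phi (f k)) ->
      (forall k, positive_rv (f k)) ->
      independent f ->
      equiv_upto C
        (expect (fun t => Phi (max_rv f t)))
        (expect (fun t =>
           Phi (rearrangement (disjoint_sum f) t * \1_(`]0, 1[%classic) t))).
Proof.
exists 2 => // n f Lf f_ge0 indep.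
have mf k : lebesgue_measurable_fun `[0, 1] (f k) by case: (Lf k).
(* This holds at every point, though the [f k] are nonnegative only almost everywhere, because the
   maximum starts from [0]. *)
have max_ge0 t : 0 <= max_rv f t by exact: bigmax_ge_id.
have rearr_ge0 t :
    0 <= rearrangement (disjoint_sum f) t * \1_(`]0, 1[%classic) t.
  by rewrite mulr_ge0// rearrangement_ge0.
split; apply: le_expect_orlicz => //; try exact: measurable_max_rv;
  try exact: measurable_rearrangement; move=> u u0;
  have [XY YX] := prob_max_rearrangement n f mf f_ge0 u indep u0 => //.
(* The first bound holds with constant [1] and is weakened to the common constant [2]. *)
by rewrite (le_trans XY)// lee_pemull ?measure_ge0// lee_fin ler1n.
Qed.
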